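(* For a Banach space $X$, $$\operatorname{N}(X)=\sup\{k: k\,r_a(x_\alpha)\le \operatorname{diam}_a(x_\alpha)\ \text{for each bounded net } (x_\alpha) \text{ in } X\}.$$
   Context: The normal structure coefficient of a Banach space $X$ is $\operatorname{N}(X)=\sup\{k: k\,r(K)\le\operatorname{diam}K\ \text{for each bounded convex set } K\subset X\}$, where $r(K)=\inf_{y\in K}\sup_{x\in K}\|x-y\|$ is the Chebyshev radius of $K$ relative to itself. For a bounded net $(x_\alpha)_{\alpha\in\mathcal A}$ in $X$ (indexed by a directed set $\mathcal A$), $r_a(x_\alpha)=\inf\{\limsup_\alpha\|x_\alpha-y\| : y\in\overline{\operatorname{conv}}(\{x_\alpha:\alpha\in\mathcal A\})\}$ and $\operatorname{diam}_a(x_\alpha)=\inf_\alpha\sup_{\beta,\gamma\ge\alpha}\|x_\beta-x_\gamma\|$ (the asymptotic diameter). *)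

(* Defs.v *)
From HB Require Import structures.
From mathcomp Require Import all_boot all_order all_algebra.
From mathcomp Require Import all_classical all_reals all_analysis.
Set Implicit Arguments.
Unset Strict Implicit.
Unset Printing Implicit Defensive.
Import Order.TTheory GRing.Theory Num.Theory.
Import numFieldNormedType.Exports.
Local Open Scope classical_set_scope.
Local Open Scope ring_scope.
Local Open Scope ereal_scope.

Section NormalStructure.
Context {R : realType} {X : normedModType R}.

Definition diameter (K : set X) : \bar R :=
  ereal_sup [set `|x - y|%:E | x in K & y in K].

Definition chebyshev_radius (K : set X) : \bar R :=
  ereal_inf [set ereal_sup [set `|x - y|%:E | x in K] | y in K].

(* The intersection of all convex sets containing S. *)
Definition convex_hull (S : set X) : set X := smallest (@convex_set R X) S.

End NormalStructure.

(* The supremum is taken in \bar R: for the zero space every real k is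
   admissible and the coefficient is +oo. The empty set, whose radius
   (inf over no centre) would be +oo, is excluded. *)
Definition normal_structure_coeff {R : realType} (X : normedModType R) : \bar R :=
  ereal_sup [set k%:E | k in [set k : R |
    forall K : set X, K !=set0 -> bounded_set K -> @convex_set R X K ->
      k%:E * chebyshev_radius K <= diameter K]].

Record directed (A : Type) (le : A -> A -> Prop) : Prop := {
  directed_inhabited : inhabited A ;
  directed_refl : forall a, le a a ;
  directed_trans : forall a b c, le a b -> le b c -> le a c ;
  directed_ub : forall a b, exists c, le a c /\ le b c }.

Section Nets.
Context {R : realType} {A : Type} (le : A -> A -> Prop).

(* [limf_esup] would require a filteredType structure on the index type. *)
Definition limsup_net (u : A -> \bar R) : \bar R :=
  ereal_inf [set ereal_sup [set u b | b in le a] | a in [set: A]].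

Context {X : normedModType R}.

Definition asymptotic_radius (x : A -> X) : \bar R :=
  ereal_inf [set limsup_net (fun a => `|x a - y|%:E) |
             y in closure (convex_hull (range x))].

Definition asymptotic_diameter (x : A -> X) : \bar R :=
  ereal_inf [set ereal_sup [set `|x b - x c|%:E | b in le a & c in le a] |
             a in [set: A]].

End Nets.

(* Main.v *)
(* The admissible constants k are the same on both sides. From convex sets to
   nets: the convex hull of a tail of the net has the diameter of that tail, and
   its points may serve as centres in the asymptotic radius. From nets to convex
   sets: index K by itself with the total preorder in which any two elements are
   comparable both ways; every tail of this net is all of K, so its asymptotic
   diameter is diam K, and its asymptotic radius is at least r(K) because
   replacing a centre in the closure of K by a nearby point of K costs
   arbitrarily little. *)
Require Import Defs.
From HB Require Import structures.
From mathcomp Require Import all_boot all_order all_algebra.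
From mathcomp Require Import unstable.
From mathcomp Require Import all_classical all_reals all_analysis.
Import Order.TTheory GRing.Theory Num.Theory.
Import numFieldNormedType.Exports.
Local Open Scope classical_set_scope.
Local Open Scope ring_scope.
Local Open Scope ereal_scope.

Section ConvexHull.
Context {R : realType} {X : normedModType R}.
Implicit Types (S K : set X) (y : X).

(** A convex hull is the smallest convex set around its generators, so a closed ball that contains
    [S] contains the hull; the estimates on hulls below rest on this. The radius is extended real so
    that it can be [diameter S] with no finiteness assumption. *)
Lemma convex_set_closed_ball y (r : \bar R) :
  @convex_set R X [set x : X | `|x - y|%:E <= r].
Proof.
move=> u v l; rewrite !inE /= => ur vr.
rewrite [X in `|X|%R](_ : _ =
  (l%:num *: (u - y) + l%:num.~ *: (v - y))%R :> X); last first.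
  by rewrite !scalerBr addrACA -opprD -scalerDl add_onemK scale1r.
(* Since [r] may be infinite, the estimate is made with the real number [m]: the weights sum to 1,
   so the combination has norm at most [m]. *)
set m := Order.max `|u - y|%R `|v - y|%R.
apply: (@le_trans _ _ m%:E); last by rewrite EFin_max ge_max ur vr.
rewrite lee_fin (le_trans (ler_normD _ _))// !normrZ.
rewrite (@ger0_norm _ l%:num)// (@ger0_norm _ l%:num.~) ?onem_ge0//.
rewrite -[leRHS]mul1r -(add_onemK l%:num) [leRHS]mulrDl.
by rewrite lerD// ler_wpM2l ?onem_ge0// le_max lexx ?orbT.
Qed.

Lemma convex_set_convex_hull S : @convex_set R X (convex_hull S).
Proof.
move=> u v l; rewrite !inE => uS vS C CS.
have := CS.1 u v l; rewrite !inE; apply; [exact: uS | exact: vS].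
Qed.

Lemma convex_hull_id K : @convex_set R X K -> convex_hull K = K.
Proof. exact: smallest_id. Qed.

Lemma bounded_convex_hull S : bounded_set S -> bounded_set (convex_hull S).
Proof.
rewrite /= /bounded_near; apply: filterS => M SM x xS /=.
rewrite -lee_fin -[x]subr0.
move: x xS; apply: smallest_sub; first exact: convex_set_closed_ball.
by move=> x Sx /=; rewrite subr0 lee_fin; exact: SM.
Qed.

Lemma diameter_convex_hull S : diameter (convex_hull S) <= diameter S.
Proof.
have hullS y : S y -> convex_hull S `<=` [set x | `|x - y|%:E <= diameter S].
  move=> Sy; apply: smallest_sub; first exact: convex_set_closed_ball.
  by move=> x Sx; apply: ereal_sup_ubound; exists x => //; exists y.
apply: ge_ereal_sup => _ [x hx [y hy <-]].
(* The two points pass from [S] to its hull one at a time: by [hullS], the ball around the hull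
   point [x] contains [S], hence also the hull. *)
rewrite distrC; move: y hy.
apply: smallest_sub; first exact: convex_set_closed_ball.
by move=> y Sy; rewrite /= distrC; exact: hullS.
Qed.

Lemma diameter_ge0 {K} : K !=set0 -> 0 <= diameter K.
Proof.
move=> [x Kx]; apply: ereal_sup_ubound.
by exists x => //; exists x => //; rewrite subrr normr0.
Qed.

Lemma chebyshev_radius_ge0 K : 0 <= chebyshev_radius K.
Proof.
apply: le_ereal_inf_tmp => _ [y Ky <-]; apply: ereal_sup_ubound.
by exists y => //; rewrite subrr normr0.
Qed.

Lemma chebyshev_radius_closure {K y} : closure K y ->
  chebyshev_radius K <= ereal_sup [set `|x - y|%:E | x in K].
Proof.
move=> clKy; apply/lee_addgt0Pr => e e0.
have [z [Kz]] := clKy _ (nbhsx_ballx y e e0); rewrite -ball_normE /= => yz.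
apply: ge_ereal_inf; eexists; first by exists z.
apply: ge_ereal_sup => _ [x Kx <-].
apply: (@le_trans _ _ (`|x - y|%:E + e%:E)).
  rewrite -EFinD lee_fin (le_trans (ler_distD y _ _))// lerD2l.
  exact: ltW.
by rewrite leeD2r//; apply: ereal_sup_ubound; exists x.
Qed.

End ConvexHull.

Section Nets.
Context {R : realType} {A : Type} (le : A -> A -> Prop).
Context {X : normedModType R} (x : A -> X).

Lemma asymptotic_radius_ge0 : directed le -> 0 <= asymptotic_radius le x.
Proof.
move=> dir; apply: le_ereal_inf_tmp => _ [y _ <-].
apply: le_ereal_inf_tmp => _ [a _ <-].
apply: le_ereal_sup_tmp; exists `|x a - y|%:E; last by rewrite lee_fin.
by exists a => //; exact: directed_refl.
Qed.

Lemma asymptotic_diameterE :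
  asymptotic_diameter le x = ereal_inf [set diameter (x @` le a) | a in setT].
Proof.
congr ereal_inf; apply: eq_imagel => a _; congr ereal_sup.
apply/seteqP; split => [_ [b ab [c ac <-]]|_ [_ [b ab <-] [_ [c ac <-] <-]]].
- by exists (x b); [exists b|exists (x c) => //; exists c].
- by exists b => //; exists c.
Qed.

(** The hull of a tail offers fewer centres than the closed hull of the range, and for each such
    centre the limsup is at most the supremum over that tail. *)
Lemma asymptotic_radius_tail a :
  asymptotic_radius le x <= chebyshev_radius (convex_hull (x @` le a)).
Proof.
apply: le_ereal_inf_tmp => _ [y hy <-].
apply: ge_ereal_inf; eexists.
  exists y => //; apply: subset_closure; move: hy.
  apply: sub_smallest2r; first exact: convex_set_convex_hull.
  by move=> _ [b _ <-]; exists b.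
apply: ge_ereal_inf; eexists; first by exists a.
apply: ge_ereal_sup => _ [b ab <-]; apply: ereal_sup_ubound.
by exists (x b) => //; apply: sub_gen_smallest; exists b.
Qed.

End Nets.

Theorem theorem3p4 (R : realType) (X : completeNormedModType R) :
  normal_structure_coeff X =
  ereal_sup [set k%:E | k in [set k : R |
    forall (A : Type) (le : A -> A -> Prop) (x : A -> X),
      directed le -> bounded_fun x ->
      k%:E * asymptotic_radius le x <= asymptotic_diameter le x]].
Proof.
congr ereal_sup; congr image; apply/seteqP; split => k kP.
- move=> A le x dir bx; rewrite asymptotic_diameterE.
  apply: le_ereal_inf_tmp => _ [a _ <-].
  have tail0 : x @` le a !=set0.
    by exists (x a); exists a => //; exact: directed_refl.
  (* For [k <= 0] the left side is nonpositive and the diameter is nonnegative; only for [k > 0]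
     does multiplication by [k] preserve the comparison of radii. *)
  have [k0|k0] := leP k 0%R.
    rewrite (le_trans _ (diameter_ge0 tail0))// mule_le0_ge0 ?lee_fin//.
    exact: asymptotic_radius_ge0.
  apply: le_trans (diameter_convex_hull _).
  apply: (@le_trans _ _ (k%:E * chebyshev_radius (convex_hull (x @` le a)))).
    apply: lee_wpmul2l; first by rewrite lee_fin ltW.
    exact: asymptotic_radius_tail.
  apply: kP; last exact: convex_set_convex_hull.
    by have [y Sy] := tail0; exists y; exact: sub_gen_smallest.
  apply: bounded_convex_hull; move: bx.
  rewrite /= /bounded_near; apply: filterS => M bM _ [b _ <-].
  exact: bM.
- move=> K K0 bK cK.
  have [k0|k0] := leP k 0%R.
    rewrite (le_trans _ (diameter_ge0 K0))// mule_le0_ge0 ?lee_fin//.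
    exact: chebyshev_radius_ge0.
  pose x (a : {x : X | K x}) : X := sval a.
  pose le (a b : {x : X | K x}) := True.
  have tailE a : x @` le a = K.
    by apply/seteqP; split => [_ [[y Ky] _ <-]|y Ky] //; exists (exist _ y Ky).
  have rangeE : range x = K.
    by apply/seteqP; split => [_ [[y Ky] _ <-]|y Ky] //; exists (exist _ y Ky).
  (* [a0] inhabits the index type, bounds every pair from above, and picks a tail for the asymptotic
     diameter. *)
  have [y0 Ky0] := K0; pose a0 : {x : X | K x} := exist _ y0 Ky0.
  have dir : directed le.
    by split => // b c; exists a0.
  have bx : bounded_fun x.
    move: bK; rewrite /= /bounded_near; apply: filterS => M bM [y Ky] _.
    exact: bM.
  apply: (@le_trans _ _ (asymptotic_diameter le x)); last first.
    rewrite asymptotic_diameterE; apply: ge_ereal_inf.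
    by exists (diameter (x @` le a0)); [exists a0|rewrite tailE].
  apply: le_trans (kP _ _ _ dir bx).
  apply: lee_wpmul2l; first by rewrite lee_fin ltW.
  rewrite /asymptotic_radius rangeE convex_hull_id//.
  apply: le_ereal_inf_tmp => _ [y /chebyshev_radius_closure Ky <-].
  apply: le_ereal_inf_tmp => _ [a _ <-].
  (* The tail at [a] runs through all of [K], so its supremum includes the distance from [y] to each
     [z] in [K]. *)
  apply: (le_trans Ky); apply: ereal_sup_le => _ [z Kz <-].
  by exists (exist _ z Kz).
Qed.
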